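(* Let $A_i$, $i\in I$, and $B_j$, $j \in J$, be residually finite groups. Let $F = \ast_{i \in I} A_i$ and $G = \ast_{j \in J} B_j$ be their free products. Let $u \in F$ be an element not belonging to any subgroup of $F$ conjugate to a free factor $A_i$, and let $v \in G$ be an element not belonging to any subgroup of $G$ conjugate to a free factor $B_j$. Let $\varphi : \langle u \rangle \to \langle v \rangle$ be the isomorphism with $\varphi(u) = v$. Then the free product with amalgamation $H$ of $F$ and $G$, in which the subgroups $\langle u\rangle$ and $\langle v\rangle$ are identified via $\varphi$, is residually finite. *)

(* Defs.v *)
From mathcomp Require Import all_boot all_fingroup.

Set Implicit Arguments.
Unset Strict Implicit.
Unset Printing Implicit Defensive.

Local Open Scope group_scope.

Definition residually_finite (G : groupType) : Prop :=
  forall g : G, g <> 1 ->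
  exists (Q : finGroupType) (f : {multiplicative G -> Q}), f g <> 1.

(* The coproduct of the family A in the category of groups. *)
Definition is_free_product (I : Type) (A : I -> groupType) (F : groupType)
    (inj : forall i : I, {multiplicative A i -> F}) : Prop :=
  forall (K : groupType) (f : forall i : I, {multiplicative A i -> K}),
  exists2 h : {multiplicative F -> K},
    (forall (i : I) (a : A i), h (inj i a) = f i a)
  & (forall h' : {multiplicative F -> K},
      (forall (i : I) (a : A i), h' (inj i a) = f i a) -> h' =1 h).

Definition in_conjugate_of_factor (I : Type) (A : I -> groupType)
    (F : groupType) (inj : forall i : I, {multiplicative A i -> F}) (u : F) :
    Prop :=
  exists (i : I) (a : A i) (g : F), u = inj i a ^ g.

Definition in_cycle (G : groupType) (u x : G) : Prop :=
  exists n : nat, x = u ^+ n \/ x = u ^- n.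

Definition cycle_of (G : groupType) (u : G) : Type := {x : G | in_cycle u x}.

Lemma in_cycle_id (G : groupType) (u : G) : in_cycle u u.
Proof. by exists 1%N; left; rewrite expg1. Qed.

Definition cycle_gen (G : groupType) (u : G) : cycle_of u :=
  exist (in_cycle u) u (in_cycle_id u).

(* Since {x | C x} is not given a group structure of its own, multiplicativity
   is expressed in the ambient groups. *)
Definition is_subgroup_iso (F G : groupType) (C : F -> Prop) (D : G -> Prop)
    (phi : {x : F | C x} -> {y : G | D y}) : Prop :=
  bijective phi /\
  (forall x y z : {x : F | C x}, sval z = sval x * sval y ->
     sval (phi z) = sval (phi x) * sval (phi y)).

(* The pushout of F and G along C -> F and C -> D -> G, where the second arrow
   is phi. *)
Definition is_amalgamated_product (F G : groupType)
    (C : F -> Prop) (D : G -> Prop) (phi : {x : F | C x} -> {y : G | D y})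
    (H : groupType) (injF : {multiplicative F -> H})
    (injG : {multiplicative G -> H}) : Prop :=
  (forall c : {x : F | C x}, injF (sval c) = injG (sval (phi c))) /\
  (forall (K : groupType) (f : {multiplicative F -> K})
      (g : {multiplicative G -> K}),
    (forall c : {x : F | C x}, f (sval c) = g (sval (phi c))) ->
    exists2 h : {multiplicative H -> K},
      (forall x : F, h (injF x) = f x) /\ (forall y : G, h (injG y) = g y)
    & (forall h' : {multiplicative H -> K},
        (forall x : F, h' (injF x) = f x) /\
        (forall y : G, h' (injG y) = g y) -> h' =1 h)).

(* Main.v *)
Require Import Defs.
From HB Require Import structures.
From mathcomp Require Import all_boot all_fingroup all_algebra cyclic boolp.

(** Cyclic reduction gives [u = c ^ g] with [c] a cyclically reduced word of
    length at least 2. Letting the letters of [c] push points around a circle,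
    and completing this partial action to a finite set (possible because the
    factors are residually finite), yields an action by permutations of [X]
    twisted by integer shifts, in which [u] has infinite order whereas every
    factor acts with bounded exponent. Hence no power of [u] is conjugate into a
    factor, and reducing the shifts modulo [n] gives a [K] such that, for every
    [l], [u] has order [K * l] in some finite quotient. As the factors therefore
    act freely on the cosets of [<u>], the same completion applied to finitely
    many cosets shows that [<u>] is closed in the profinite topology.

    So a reduced word of the amalgam survives in finite quotients [P] of [F] and
    [Q] of [G] in which [u] and [v] have the same order and the letters stay
    outside the amalgamated cycles. Gluing copies of the regular representations
    of [P] and [Q] along cycles of [u] and [v], so that the word travels along a
    chain of copies, gives a finite permutation representation moving a point. *)

Set Implicit Arguments.
Unset Strict Implicit.
Unset Printing Implicit Defensive.

Import GRing.Theory Num.Theory.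

Local Open Scope group_scope.

(** * Morphisms and generation *)

Section Morphisms.

Variables G H : groupType.

Lemma gmorph1 (f : {multiplicative G -> H}) : f 1 = 1.
Proof. by apply: (mulgI (f 1)); rewrite -gmulfM !mulg1. Qed.

Lemma gmorphV (f : {multiplicative G -> H}) x : f x^-1 = (f x)^-1.
Proof. by apply: (mulgI (f x)); rewrite -gmulfM !mulgV gmorph1. Qed.

Lemma gmorphX (f : {multiplicative G -> H}) x n : f (x ^+ n) = f x ^+ n.
Proof. by elim: n => [|n IHn]; rewrite ?gmorph1 // !expgS gmulfM IHn. Qed.

Lemma gmorphJ (f : {multiplicative G -> H}) x y : f (x ^ y) = f x ^ f y.
Proof. by rewrite !conjgE !gmulfM gmorphV. Qed.

Definition gmorph_of (f : G -> H) (fM : {morph f : x y / x * y}) :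
    {multiplicative G -> H} :=
  HB.pack f (isMultiplicative.Build G H f fM).

Definition trivial_gmorph : {multiplicative G -> H} :=
  gmorph_of (fun _ _ => esym (mulg1 1) : (fun=> 1) _ = _).

Definition conj_gmorph (f : {multiplicative G -> H}) (y : H) :
    {multiplicative G -> H}.
Proof.
apply: (@gmorph_of (fun x => f x ^ y)) => a b.
by rewrite gmulfM conjMg.
Defined.

End Morphisms.

Definition comp_gmorph (G H K : groupType) (f : {multiplicative H -> K})
    (g : {multiplicative G -> H}) : {multiplicative G -> K} :=
  f \o g.

Definition pair_gmorph (G : groupType) (P Q : finGroupType)
    (f : {multiplicative G -> P}) (g : {multiplicative G -> Q}) :
  {multiplicative G -> (P * Q)%type}.
Proof.
apply: (@gmorph_of _ _ (fun x => (f x, g x))) => a b.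
by rewrite !gmulfM.
Defined.

Section Generation.

Variables (G : groupType) (S : G -> Prop).
Hypotheses (S1 : S 1) (SM : forall x y, S x -> S y -> S (x * y))
  (SV : forall x, S x -> S x^-1).

Definition in_closed : pred G := fun x => `[< S x >].

Lemma in_closed_group : group_closed in_closed.
Proof.
split; first exact/asboolP.
by move=> x y /asboolP Sx /asboolP Sy; apply/asboolP/SM/SV.
Qed.

Record closed_sub := ClosedSub { closed_val : G; _ : in_closed closed_val }.
HB.instance Definition _ := [isSub for closed_val].
HB.instance Definition _ := [Choice of closed_sub by <:].
HB.instance Definition _ :=
  SubChoice_isSubGroup.Build G in_closed closed_sub in_closed_group.

Definition closed_incl : {multiplicative closed_sub -> G} :=
  gmorph_of (fun x y : closed_sub => valM x y).

Lemma closed_inclP (x : closed_sub) : S (closed_incl x).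
Proof. exact/asboolP/(valP x). Qed.

Lemma closed_lift (A : groupType) (f : {multiplicative A -> G}) :
  (forall a, S (f a)) ->
  exists f' : {multiplicative A -> closed_sub},
    forall a, closed_incl (f' a) = f a.
Proof.
move=> Sf; pose f' a := ClosedSub (asboolT (Sf a)).
have f'M : {morph f' : x y / x * y} by move=> x y; apply/val_inj;
  rewrite valM /= gmulfM.
by exists (gmorph_of f'M).
Qed.

End Generation.

Lemma free_product_gen (I : Type) (A : I -> groupType) (F : groupType)
    (inj : forall i, {multiplicative A i -> F}) (S : F -> Prop) :
  is_free_product inj ->
  S 1 -> (forall x y, S x -> S y -> S (x * y)) ->
  (forall x, S x -> S x^-1) -> (forall i a, S (inj i a)) ->
  forall x, S x.
Proof.
move=> hF S1 SM SV Sinj x.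
pose f i := sval (cid (closed_lift S1 SM SV (Sinj i))).
have fE i a : closed_incl S1 SM SV (f i a) = inj i a.
  exact: (svalP (cid (closed_lift S1 SM SV (Sinj i)))).
have [h hE _] := hF _ f.
have [k _ k_uniq] := hF _ inj.
have -> : x = closed_incl S1 SM SV (h x).
  transitivity (k x).
    exact: (k_uniq (gmorph_of (f := id) (fun x y => erefl (x * y)))).
  apply/esym/(k_uniq (comp_gmorph (closed_incl S1 SM SV) h)) => i a.
  by rewrite -[RHS]fE -hE.
exact: closed_inclP.
Qed.

Lemma amalgamated_product_gen (F G : groupType) (C : F -> Prop) (D : G -> Prop)
    (phi : {x | C x} -> {y | D y}) (H : groupType)
    (injF : {multiplicative F -> H}) (injG : {multiplicative G -> H})
    (S : H -> Prop) :
  is_amalgamated_product phi injF injG ->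
  S 1 -> (forall x y, S x -> S y -> S (x * y)) ->
  (forall x, S x -> S x^-1) ->
  (forall x, S (injF x)) -> (forall y, S (injG y)) ->
  forall x, S x.
Proof.
move=> [compat hH] S1 SM SV SF SG x.
have [f fE] := closed_lift S1 SM SV SF.
have [g gE] := closed_lift S1 SM SV SG.
have [|h [hF hG] _] := hH _ f g.
  by move=> c; apply: val_inj;
    exact: etrans (fE _) (etrans (compat c) (esym (gE _))).
have [k _ k_uniq] := hH _ _ _ compat.
have -> : x = closed_incl S1 SM SV (h x).
  transitivity (k x).
    exact: (k_uniq (gmorph_of (f := id) (fun x y => erefl (x * y)))).
  apply/esym/(k_uniq (comp_gmorph (closed_incl S1 SM SV) h)).
  by split=> y; [rewrite -[RHS]fE -hF | rewrite -[RHS]gE -hG].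
exact: closed_inclP.
Qed.

(** * Completing partial actions *)

Lemma residually_finite_seq (A : groupType) (s : seq A) :
  residually_finite A -> (forall a, a \in s -> a != 1) ->
  exists (Q : finGroupType) (f : {multiplicative A -> Q}),
    forall a, a \in s -> f a != 1.
Proof.
move=> rfA; elim: s => [|b s IHs] s1.
  by exists {perm 'I_1}, (trivial_gmorph A _).
have [|Q [f fP]] := IHs; first by move=> a sa; apply: s1; rewrite inE sa orbT.
have [|P [g gP]] := rfA b; first by apply/eqP/s1; rewrite inE eqxx.
exists (P * Q)%type, (pair_gmorph g f) => a; rewrite inE => /predU1P[->|sa].
  by apply/eqP=> -[/gP].
by apply/eqP=> -[_ /eqP]; apply/negP/fP.
Qed.

Lemma perm_extension (Y X : finType) (e : Y -> X) : injective e ->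
  exists E : {multiplicative {perm Y} -> {perm X}},
    forall p y, E p (e y) = e (p y).
Proof.
move=> e_inj.
pose ext (p : {perm Y}) x := if [pick y | e y == x] is Some y then e (p y) else
  x.
have extE p y : ext p (e y) = e (p y).
  rewrite /ext; case: pickP => [z /eqP/e_inj->//|/(_ y)].
  by rewrite eqxx.
have ext_out p x : (forall y, e y != x) -> ext p x = x.
  by rewrite /ext; case: pickP => // y /eqP<- /(_ y); rewrite eqxx.
have ext_cases x : (exists y, x = e y) \/ forall y, e y != x.
  case: (pickP (fun y => e y == x)) => [y /eqP<-|ex]; first by left; exists y.
  by right=> y; rewrite ex.
have extK p : cancel (ext p) (ext p^-1).
  move=> x; have [[y ->]|x_out] := ext_cases x; first by rewrite !extE permK.
  by rewrite !ext_out // ext_out.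
have EM : {morph (fun p => perm (can_inj (extK p))) : p q / p * q}.
  move=> p q; apply/permP=> x; rewrite permM !permE.
  have [[y ->]|x_out] := ext_cases x; first by rewrite !extE permM.
  by rewrite !ext_out // ext_out.
by exists (gmorph_of EM) => p y; rewrite /= permE extE.
Qed.

(* The chart [s |-> (rho s, g s)] presents [S] as a finite piece of a free
   [A]-set: [s] is the translate by [g s] of the orbit representative [rho s]. *)
Lemma chart_action (A : groupType) (S : finType) (rho : S -> S) (g : S -> A) :
  residually_finite A -> injective (fun s => (rho s, g s)) ->
  exists M0, forall M, M0 <= M ->
  exists f : {multiplicative A -> {perm (S + 'I_M)}},
  forall s s' a, rho s' = rho s -> g s' = g s * a -> f a (inl s) = inl s'.
Proof.
move=> rfA chart_inj.
pose diffs := [seq a <- [seq (g s)^-1 * g s' | s <- enum S,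
  s' <- enum S] | a != 1].
have [|Q [q qP]] := residually_finite_seq (s := diffs) rfA.
  by move=> a; rewrite mem_filter => /andP[].
pose i s := (rho s, q (g s)).
have i_inj : injective i.
  move=> s s' [rho_eq q_eq]; apply: chart_inj; congr (_, _) => //.
  apply/eqP/idPn => neq.
  have/qP : (g s)^-1 * g s' \in diffs.
    rewrite mem_filter; apply/andP; split; last first.
      by apply/allpairsP; exists (s, s'); rewrite /= !mem_enum.
    by apply/eqP => /mulg1_eq; rewrite invgK; apply/eqP.
  by rewrite gmulfM gmorphV q_eq mulVg eqxx.
exists #|{: S * Q}| => M leM.
pose e (y : S * Q) : S + 'I_M := if [pick s | i s == y] is Some s then inl s
  else inr (widen_ord leM (enum_rank y)).
have eE s : e (i s) = inl s.
  by rewrite /e; case: pickP => [t /eqP/i_inj->//|/(_ s)]; rewrite eqxx.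
have e_inj : injective e.
  move=> y z; rewrite /e.
  case: pickP => [s /eqP<-|_]; case: pickP => [t /eqP<-|_] // [].
    by move=> ->.
  by move/val_inj => /enum_rank_inj.
have [E EE] := perm_extension e_inj.
have actK (b : Q) : cancel (fun y : S * Q => (y.1, y.2 * b)) (fun y => (y.1,
  y.2 * b^-1)).
  by case=> t x /=; rewrite mulgK.
have actM : {morph (fun a => perm (can_inj (actK (q a)))) : a b / a * b}.
  by move=> a b; apply/permP=> -[t x]; rewrite permM !permE /= gmulfM mulgA.
exists (comp_gmorph E (gmorph_of actM)) => s s' a rho_eq g_eq.
by rewrite -!eE /= EE permE /i /= rho_eq g_eq gmulfM.
Qed.

Lemma local_action (I : Type) (A : I -> groupType) (F : groupType)
    (inj : forall i, {multiplicative A i -> F}) (S K : finType)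
    (rho : I -> S -> S) (g : forall i, S -> A i) (l : K -> I) :
  (forall i, residually_finite (A i)) -> is_free_product inj ->
  (forall i, injective (fun s => (rho i s, g i s))) ->
  exists (X : finType) (j : S -> X) (f : {multiplicative F -> {perm X}}),
  injective j /\
  forall k s s' a, rho (l k) s' = rho (l k) s ->
    g (l k) s' = g (l k) s * a -> f (inj (l k) a) (j s) = j s'.
Proof.
move=> rfA hF chart_inj.
have [M0 M0P] := choice (fun k :
  K => chart_action (rfA (l k)) (chart_inj (l k))).
pose M := \max_k M0 k.
have ex_f i : exists f : {multiplicative A i -> {perm (S + 'I_M)}},
    (exists k, l k = i) -> forall s s' a,
    rho i s' = rho i s -> g i s' = g i s * a -> f a (inl s) = inl s'.
  have [[k <-]|nil] := pselect (exists k, l k = i); last first.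
    by exists (trivial_gmorph _ _).
  by have [f fP] := M0P k M (leq_bigmax k); exists f.
have [h hE _] := hF _ (fun i => sval (cid (ex_f i))).
exists (S + 'I_M)%type, inl, h; split; first by move=> s t [].
move=> k s s' a; rewrite hE.
by apply: (svalP (cid (ex_f (l k)))); exists k.
Qed.

(** * Permutations twisted by integer shifts *)

(* [(s, h)] stands for the permutation [(x, t) |-> (s x, t + h x)] of [X * int]. *)
Definition shiftperm (X : finType) : Type := ({perm X} * {ffun X -> int})%type.

HB.instance Definition _ (X : finType) := Choice.on (shiftperm X).

Section ShiftPerm.

Variable X : finType.
Implicit Types p q : shiftperm X.

Definition shiftperm_one : shiftperm X := (1, [ffun=> 0%R]).

Definition shiftperm_mul p q : shiftperm X :=
  (p.1 * q.1, [ffun x => (p.2 x + q.2 (p.1 x))%R]).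

Definition shiftperm_inv p : shiftperm X :=
  (p.1^-1, [ffun x => (- p.2 (p.1^-1%g x))%R]).

Lemma shiftperm_mulA : associative shiftperm_mul.
Proof.
move=> p q s; congr (_, _); first exact: mulgA.
by apply/ffunP=> x; rewrite !ffunE permM addrA.
Qed.

Lemma shiftperm_mul1 : left_id shiftperm_one shiftperm_mul.
Proof.
case=> p h; congr (_, _); first exact: mul1g.
by apply/ffunP=> x; rewrite !ffunE perm1 add0r.
Qed.

Lemma shiftperm_1mul : right_id shiftperm_one shiftperm_mul.
Proof.
case=> p h; congr (_, _); first exact: mulg1.
by apply/ffunP=> x; rewrite !ffunE addr0.
Qed.

Lemma shiftperm_mulV : left_inverse shiftperm_one shiftperm_inv shiftperm_mul.
Proof.
case=> p h; congr (_, _); first exact: mulVg.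
by apply/ffunP=> x; rewrite !ffunE addNr.
Qed.

Lemma shiftperm_Vmul : right_inverse shiftperm_one shiftperm_inv shiftperm_mul.
Proof.
case=> p h; congr (_, _); first exact: mulgV.
by apply/ffunP=> x; rewrite !ffunE /= permK addrN.
Qed.

HB.instance Definition _ := isGroup.Build (shiftperm X) shiftperm_mulA
  shiftperm_mul1 shiftperm_1mul shiftperm_mulV shiftperm_Vmul.

Lemma shiftperm_fstM p q : (p * q).1 = p.1 * q.1.
Proof. by []. Qed.

Lemma shiftperm_sndM p q x : (p * q).2 x = (p.2 x + q.2 (p.1 x))%R.
Proof. by rewrite ffunE. Qed.

Lemma shiftperm_snd1 x : (1 : shiftperm X).2 x = 0%R.
Proof. by rewrite ffunE. Qed.

Lemma shiftperm_fstX p n : (p ^+ n).1 = p.1 ^+ n.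
Proof. by elim: n => // n IHn; rewrite !expgS shiftperm_fstM IHn. Qed.

Lemma const_shiftM :
  {morph (fun s : {perm X} => (s, [ffun=> 0%R]) : shiftperm X) :
     s t / s * t}.
Proof. by move=> s t; congr (_, _); apply/ffunP=> x; rewrite !ffunE addr0. Qed.

Definition const_shift : {multiplicative {perm X} -> shiftperm X} :=
  gmorph_of const_shiftM.

Lemma const_shift_conj (d : {ffun X -> int}) (s : {perm X}) x :
  (const_shift s ^ ((1, d) : shiftperm X)).1 = s /\
  (const_shift s ^ ((1, d) : shiftperm X)).2 x = (d (s x) - d x)%R.
Proof.
rewrite !conjgE; have -> : ((1, d) : shiftperm X)^-1 = (1,
  [ffun y => (- d y)%R]).
  by congr (_, _); [exact: invg1 | apply/ffunP=> y; rewrite !ffunE invg1 perm1].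
rewrite !shiftperm_fstM !shiftperm_sndM /= mulg1 mul1g; split=> //.
by rewrite !ffunE /= perm1 add0r addrC.
Qed.

Lemma shiftperm_fixX p x n : p.1 x = x -> (p ^+ n).2 x = (p.2 x *+ n)%R.
Proof.
move=> px; elim: n => [|n IHn]; first by rewrite shiftperm_snd1.
by rewrite expgS shiftperm_sndM px IHn mulrS.
Qed.

End ShiftPerm.

Section Reduction.
Variables (X : finType) (n : nat).
Implicit Types p q : shiftperm X.

Definition shiftperm_act p (y : X * 'I_n.+1) : X * 'I_n.+1 :=
  (p.1 y.1, (y.2 + inZp 1 *~ p.2 y.1)%R).

Lemma shiftperm_actM p q y :
  shiftperm_act (p * q) y = shiftperm_act q (shiftperm_act p y).
Proof.
by rewrite /shiftperm_act shiftperm_sndM permM mulrzDr addrA.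
Qed.

Lemma shiftperm_act1 y : shiftperm_act 1 y = y.
Proof.
by case: y => x t; rewrite /shiftperm_act shiftperm_snd1 perm1 addr0.
Qed.

Lemma shiftperm_actK p : cancel (shiftperm_act p) (shiftperm_act p^-1).
Proof. by move=> y; rewrite -shiftperm_actM mulgV shiftperm_act1. Qed.

Lemma shiftperm_redM :
  {morph (fun p => perm (can_inj (shiftperm_actK p))) : p q / p * q}.
Proof.
by move=> p q; apply/permP=> y; rewrite permM !permE shiftperm_actM.
Qed.

Definition shiftperm_red :
    {multiplicative shiftperm X -> {perm (X * 'I_n.+1)}} :=
  gmorph_of shiftperm_redM.

Lemma shiftperm_red_eq1 p :
  shiftperm_red p = 1 <-> p.1 = 1 /\ forall x, n.+1 %| `|p.2 x|%N.
Proof.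
have inZp_eq0 (z : int) : ((inZp 1 : 'I_n.+1) *~ z == 0)%R = (n.+1 %| `|z|%N).
  have nat_case m : ((inZp 1 : 'I_n.+1) *+ m == 0)%R = (n.+1 %| m).
    by rewrite Zp_mulrn -val_eqE /= modnMml mul1n.
  case: z => m; first by rewrite -pmulrn nat_case.
  by rewrite NegzE mulrNz oppr_eq0 -pmulrn nat_case abszN.
split=> [/permP red1|[p1 p2]].
  split=> [|x]; first by apply/permP=> x; have := red1 (x, 0%R);
    rewrite !permE => -[].
  have /(congr1 snd) := red1 (x, 0%R); rewrite !permE /shiftperm_act add0r.
  by move=> /eqP; rewrite inZp_eq0.
apply/permP=> -[x t]; rewrite !permE /shiftperm_act /= p1 perm1.
by have /eqP-> : ((inZp 1 : 'I_n.+1) *~ p.2 x == 0)%R; rewrite ?inZp_eq0 ?addr0.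
Qed.

End Reduction.

Lemma shiftperm_finite_orders (X : finType) (p : shiftperm X) :
  (forall n, 0 < n -> p ^+ n <> 1) ->
  exists2 K, 0 < K & forall l, 0 < l ->
    exists (Q : finGroupType) (f : {multiplicative shiftperm X -> Q}),
      #[f p] = (K * l)%N.
Proof.
move=> p_inf; pose N := #[p.1]; pose h := (p ^+ N).2.
have pN1 : (p ^+ N).1 = 1 by rewrite shiftperm_fstX expg_order.
have pNX t x : (p ^+ (N * t)).2 x = (h x *+ t)%R.
  by rewrite expgnA shiftperm_fixX // pN1 perm1.
pose d := \big[gcdn/0]_(x : X) `|h x|%N.
have d_gt0 : 0 < d.
  rewrite lt0n; apply/eqP => d0; apply: (p_inf N); first exact: order_gt0.
  rewrite [LHS]surjective_pairing pN1; congr (_, _); apply/ffunP => x.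
  by rewrite ffunE; apply/eqP; rewrite -absz_eq0 -dvd0n -d0;
    exact: (biggcdn_inf x).
exists N => [|l l_gt0]; first exact: order_gt0.
have dlE : (d * l).-1.+1 = (d * l)%N by rewrite prednK // muln_gt0 d_gt0.
exists {perm (X * 'I_(d * l).-1.+1)}, (shiftperm_red X _); apply/eqP.
rewrite eqn_dvd order_dvdn; apply/andP; split.
  rewrite -gmorphX; apply/eqP/shiftperm_red_eq1; split.
    by rewrite shiftperm_fstX expgnA expg_order expg1n.
  move=> x; rewrite dlE pNX -mulr_natr natz abszM dvdn_mul //.
  exact: (biggcdn_inf x).
have := expg_order (shiftperm_red X (d * l).-1 p).
move: #[_] => m; rewrite -gmorphX => /shiftperm_red_eq1[].
rewrite shiftperm_fstX => /eqP; rewrite -order_dvdn -/N => /dvdnP[t ->].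
rewrite (mulnC t) dvdn_pmul2l ?order_gt0 // => div.
rewrite -(dvdn_pmul2l d_gt0) -[X in X %| _]dlE (mulnC d t).
rewrite /d (big_morph (muln t) (muln_gcdr t) (muln0 t)).
apply/dvdn_biggcdP => x _; have := div x.
by rewrite -/d pNX -mulr_natr natz abszM (mulnC t).
Qed.

(** * Cyclic reduction and the circle action *)

Section FreeProduct.

Variables (I : Type) (A : I -> groupType) (F : groupType).
Variable inj : forall i, {multiplicative A i -> F}.

Definition letter (s : {i & A i}) : F := inj (tag s) (tagged s).

Definition eval_word (w : seq {i & A i}) : F := \prod_(s <- w) letter s.

Lemma eval_word_cat w1 w2 :
  eval_word (w1 ++ w2) = eval_word w1 * eval_word w2.
Proof. by rewrite /eval_word big_cat. Qed.

Lemma eval_word_cons s w : eval_word (s :: w) = letter s * eval_word w.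
Proof. by rewrite /eval_word big_cons. Qed.

Lemma eval_word_rot k w :
  eval_word w = eval_word (rot k w) ^ (eval_word (take k w))^-1.
Proof.
rewrite -{1}(cat_take_drop k w) /rot !eval_word_cat conjgE invgK.
by rewrite !mulgA mulgK.
Qed.

Hypothesis hF : is_free_product inj.

Lemma free_product_word x : exists w, x = eval_word w.
Proof.
move: x; apply: (free_product_gen hF).
- by exists [::]; rewrite /eval_word big_nil.
- by move=> _ _ [w1 ->] [w2 ->]; exists (w1 ++ w2); rewrite eval_word_cat.
- move=> _ [w ->]; exists (rev [seq existT (fun i =>
    A i) (tag s) (tagged s)^-1 | s <- w]).
  elim: w => [|s w IHw]; first by rewrite /eval_word !big_nil invg1.
  rewrite /= rev_cons -cats1 eval_word_cat -IHw !eval_word_cons invgM.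
  by rewrite /eval_word big_nil mulg1 /letter /= gmorphV.
- by move=> i a; exists [:: existT (fun i => A i) i a];
    rewrite /eval_word big_seq1.
Qed.

Definition cyclically_reduced n (sigma : 'I_n -> {i & A i}) :=
  forall k, tagged (sigma k) <> 1 /\ tag (sigma k) <> tag (sigma (ordS k)).

Lemma cyclic_reduction u : u <> 1 -> ~ in_conjugate_of_factor inj u ->
  exists n (sigma : 'I_n.+2 -> {i & A i}) g,
    cyclically_reduced sigma /\ u = (\prod_(k < n.+2) letter (sigma k)) ^ g.
Proof.
move=> u1 u_conj.
pose P n := `[< exists w g, size w = n /\ u = eval_word w ^ g >].
have exP : exists n, P n.
  have [w uE] := free_product_word u.
  by exists (size w); apply/asboolP; exists w, 1; rewrite conjg1.
have [m /asboolP[w [g [wm uE]]] min_m] := ex_minnP exP.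
have minimal w' g' : u = eval_word w' ^ g' -> m <= size w'.
  by move=> uE'; apply: min_m; apply/asboolP; exists w', g'.
have rot_uE k : u = eval_word (rot k w) ^ ((eval_word (take k w))^-1 * g).
  by rewrite conjgM -eval_word_rot.
have short w' g' : size w' < m -> u <> eval_word w' ^ g'.
  by move=> lt_m /minimal; rewrite leqNgt lt_m.
case: m => [|[|n]] in wm min_m minimal short.
- by case: u1; rewrite uE (size0nil wm) /eval_word big_nil conj1g.
- case: w wm uE {rot_uE} => [|s [|]] // _; rewrite eval_word_cons /eval_word.
  rewrite big_nil mulg1 => uE; case: u_conj.
  by exists (tag s), (tagged s), g.
have s0 : {i & A i} by case: (w) wm.
exists n, (fun k => nth s0 w k), g; split; last first.
  by rewrite uE /eval_word (big_nth s0) wm big_mkord.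
move=> k.
have [w' rotE] : exists w',
    rot k w = nth s0 w k :: nth s0 w (ordS k) :: w'.
  have ltk := ltn_ord k; rewrite /rot (drop_nth s0) ?wm //= .
  have [lt_k1|] := ltnP k.+1 n.+2.
    by rewrite modn_small // (drop_nth s0) ?wm //=; eexists.
  rewrite leq_eqVlt ltnNge ltk orbF => /eqP kE.
  rewrite -kE modnn drop_oversize ?wm //=.
  case: (nat_of_ord k) (w) kE wm => [|k'] [|s w0] // _ _; by eexists.
have size_w' : size w' = n.
  by move/(congr1 size): rotE; rewrite size_rot wm /= => -[].
have {}rot_uE := rot_uE k; rewrite rotE !eval_word_cons in rot_uE.
move: (nth s0 w k) (nth s0 w (ordS k)) rot_uE => [i a] [j b] /= rot_uE.
split=> [a1|eq_ij].
  apply: (short (existT _ j b :: w') ((eval_word (take k w))^-1 * g)).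
    by rewrite /= size_w'.
  by rewrite eval_word_cons rot_uE {1}/letter /= a1 gmorph1 mul1g.
case: j / eq_ij => /= in b rot_uE *.
apply: (short (existT _ i (a * b) :: w') ((eval_word (take k w))^-1 * g)).
  by rewrite /= size_w'.
by rewrite eval_word_cons rot_uE /letter /= gmulfM mulgA.
Qed.

End FreeProduct.

Section FreeProduct.

Variables (I : Type) (A : I -> groupType) (F : groupType).
Variable inj : forall i, {multiplicative A i -> F}.
Hypothesis hF : is_free_product inj.
Hypothesis rfA : forall i, residually_finite (A i).

Section Circle.

Variables (n : nat) (sigma : 'I_n.+2 -> {i & A i}).
Hypothesis red_sigma : cyclically_reduced sigma.

Definition circle_chart i (k : 'I_n.+2) : 'I_n.+2 * A i :=
  match pselect (tag (sigma (ord_pred k)) = i) with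
  | left e => (ord_pred k, ecast j (A j) e (tagged (sigma (ord_pred k))))
  | right _ => (k, 1)
  end.

Lemma circle_chart_source k : circle_chart (tag (sigma k)) k = (k, 1).
Proof.
rewrite /circle_chart; case: pselect => // e.
by have [_] := red_sigma (ord_pred k); rewrite ord_predK.
Qed.

Lemma circle_chart_target k :
  circle_chart (tag (sigma k)) (ordS k) = (k, tagged (sigma k)).
Proof.
rewrite /circle_chart ordSK; case: pselect => // e.
by rewrite (Prop_irrelevance e erefl).
Qed.

Lemma circle_chart_inj i : injective (circle_chart i).
Proof.
have mixed k k' : tag (sigma (ord_pred k)) = i -> circle_chart i k <> (k', 1).
  move=> e; rewrite /circle_chart; case: pselect => // e'.
  case: i / e' {e} => /= -[_]; exact: (red_sigma _).1.
move=> k k'; case: (pselect (tag (sigma (ord_pred k)) = i)) => [e|ne];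
  case: (pselect (tag (sigma (ord_pred k')) = i)) => [e'|ne'].
- rewrite /circle_chart; case: pselect => // ?; case: pselect => // ?.
  by move/(congr1 fst)/(can_inj (@ord_predK _)).
- rewrite [RHS]/circle_chart; case: pselect => // _.
  by move/(mixed _ _ e).
- rewrite [LHS]/circle_chart; case: pselect => // _.
  by move/esym/(mixed _ _ e').
- by rewrite /circle_chart; case: pselect => // ?; case: pselect => // ? [].
Qed.

(* The letters of the reduced word push the points of a circle one step forward.
   The coboundary of the indicator of point 1, used for the factor of the first
   letter only, makes the turn around the circle shift by 1. *)
Lemma circle_action :
  exists (X : finType) (f : {multiplicative F -> shiftperm X}),
  (exists2 e, 0 < e & forall i a, f (inj i a) ^+ e = 1) /\
  exists x0, (f (\prod_(k < n.+2) letter inj (sigma k))).1 x0 = x0 /\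
             (f (\prod_(k < n.+2) letter inj (sigma k))).2 x0 = 1%R.
Proof.
have [X [j [f0 [j_inj f0P]]]] := local_action (fun k => tag (sigma k)) rfA hF
  (rho := fun i k => (circle_chart i k).1) (g := fun i k =>
    (circle_chart i k).2)
  (fun i k k' => fun e => @circle_chart_inj i k k'
     (etrans (surjective_pairing _) (etrans e (esym (surjective_pairing _))))).
have step0 k : f0 (letter inj (sigma k)) (j k) = j (ordS k).
  apply: f0P; rewrite circle_chart_source circle_chart_target //=.
  by rewrite mul1g.
pose d i : {ffun X -> int} :=
  [ffun x => if pselect (i = tag (sigma ord0)) then (x == j (ordS ord0))%:R%R
    else 0%R].
pose f1 i := conj_gmorph (comp_gmorph (const_shift X) (comp_gmorph f0 (inj i)))
  ((1, d i) : shiftperm X).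
have [f fE _] := hF f1.
exists X, f; split.
  exists #|{perm X}| => [|i a]; first by apply/card_gt0P; exists 1.
  rewrite fE -conjXg -[LHS]/((const_shift X (f0 (inj i a)) ^+ _) ^ _).
  by rewrite -gmorphX -cardsT expg_cardG ?inE // gmorph1 conj1g.
have step k : (f (letter inj (sigma k))).1 (j k) = j (ordS k) /\
              (f (letter inj (sigma k))).2 (j k) = (k == ord0)%:R%R.
  rewrite /letter fE.
  have [-> ->] := const_shift_conj (d (tag (sigma k))) (f0 (letter inj (sigma
    k))) (j k).
  rewrite step0; split=> //; rewrite !ffunE !(inj_eq j_inj).
  rewrite (inj_eq (can_inj (@ordSK _))).
  case: pselect => [e|ne]; last first.
    by have [k0|] := eqVneq k ord0; rewrite ?subr0 //; case: ne; rewrite k0.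
  have [k1|_] := eqVneq k (ordS ord0); last by rewrite subr0.
  by have [_] := red_sigma ord0; rewrite -k1; case: (esym e).
exists (j ord0).
have partial m : m <= n.+2 ->
    let p := f (\prod_(0 <= k < m) letter inj (sigma (inord k))) in
    p.1 (j ord0) = j (inord (m %% n.+2)) /\ p.2 (j ord0) = (0 < m)%:R%R.
  elim: m => [|m IHm] lem /=.
    rewrite big_geq // gmorph1 perm1 shiftperm_snd1 mod0n; split=> //.
    by congr j; apply: val_inj; rewrite /= inordK.
  have [IH1 IH2] := IHm (ltnW lem).
  rewrite big_nat_recr //= gmulfM shiftperm_fstM shiftperm_sndM permM.
  rewrite IH1 IH2 modn_small //; have [-> ->] := step (inord m); split.
    by congr j; apply: val_inj; rewrite /= !inordK // ltn_mod.
  rewrite -val_eqE /= inordK //; case: (m) => //.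
have := partial n.+2 (leqnn _); rewrite big_mkord modnn /=.
have -> : inord 0 = ord0 :> 'I_n.+2 by apply: val_inj; rewrite /= inordK.
suff -> : \prod_(k < n.+2) letter inj (sigma (inord k)) =
  \prod_(k < n.+2) letter inj (sigma k) by [].
by apply: eq_bigr => k _; rewrite inord_val.
Qed.

End Circle.

Variables (u : F) (u1 : u <> 1) (u_conj : ~ in_conjugate_of_factor inj u).

Lemma hyperbolic_action :
  exists (X : finType) (f : {multiplicative F -> shiftperm X}),
  (exists2 e, 0 < e & forall i a, f (inj i a) ^+ e = 1) /\
  forall n, 0 < n -> f u ^+ n <> 1.
Proof.
have [n [sigma [g [red_sigma ->]]]] := cyclic_reduction hF u1 u_conj.
have [X [f [fe [x0 [fx0 shift_x0]]]]] := circle_action red_sigma.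
exists X, f; split=> // m m_gt0 /eqP.
rewrite gmorphJ -conjXg conjg_eq1 => /eqP/(congr1 (fun p :
  shiftperm X => p.2 x0)).
rewrite shiftperm_fixX // shift_x0 shiftperm_snd1 => /eqP.
by rewrite pnatr_eq0 -leqn0 leqNgt m_gt0.
Qed.

Lemma hyperbolic_power_conj n i (a : A i) g :
  0 < n -> u ^+ n <> inj i a ^ g.
Proof.
move=> n_gt0 uE; have [X [f [[e e_gt0 fe] f_inf]]] := hyperbolic_action.
apply: (f_inf (n * e)%N); first by rewrite muln_gt0 n_gt0.
by rewrite expgnA -gmorphX uE gmorphJ -conjXg fe conj1g.
Qed.

Lemma hyperbolic_finite_orders :
  exists2 K, 0 < K & forall l, 0 < l ->
    exists (Q : finGroupType) (f : {multiplicative F -> Q}), #[f u] = (K * l)%N.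
Proof.
have [X [f [_ f_inf]]] := hyperbolic_action.
have [K K_gt0 KP] := shiftperm_finite_orders f_inf.
exists K => // l /KP[Q [q qE]].
by exists Q, (comp_gmorph q f).
Qed.

End FreeProduct.

(** * Separability of the cyclic subgroup *)

Section Cycle.

Variables (G : groupType) (u : G).

Lemma in_cycle1 : in_cycle u 1.
Proof. by exists 0; left. Qed.

Lemma in_cycleV x : in_cycle u x -> in_cycle u x^-1.
Proof. by case=> n [->|->]; exists n; rewrite ?invgK; [right|left]. Qed.

Lemma in_cycle_div n m : in_cycle u (u ^+ n * u ^- m).
Proof.
have [le_mn|/ltnW le_nm] := leqP m n.
  by exists (n - m); left; rewrite expgnFr.
by exists (m - n); right; rewrite expgnFr // invgF.
Qed.

Lemma in_cycleM x y : in_cycle u x -> in_cycle u y -> in_cycle u (x * y).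
Proof.
case=> n [->|->] [m [->|->]]; first by exists (n + m); left; rewrite expgnDr.
- exact: in_cycle_div.
- rewrite -(commuteV (commuteX2 m n (commute_refl u))); exact: in_cycle_div.
- by exists (m + n); right; rewrite expgnDr invgM.
Qed.

Definition coset_rep x : G := choose (fun y => `[< in_cycle u (y * x^-1) >]) x.

Lemma coset_rep_cycle x : in_cycle u (coset_rep x * x^-1).
Proof.
apply/asboolP; apply: (@chooseP _ (fun y => `[< in_cycle u (y * x^-1) >])).
by apply/asboolP; rewrite mulgV; apply: in_cycle1.
Qed.

Lemma coset_repP x y : coset_rep x = coset_rep y <-> in_cycle u (x * y^-1).
Proof.
have cycle_trans z x' y' : in_cycle u (z * x'^-1) -> in_cycle u (x' * y'^-1) ->
  in_cycle u (z * y'^-1).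
  by move=> zx xy; rewrite -(divgKA x'); apply: in_cycleM.
split=> [eq_rep|xy].
  apply: cycle_trans (coset_rep_cycle y); rewrite -eq_rep -invgF.
  exact/in_cycleV/coset_rep_cycle.
rewrite /coset_rep.
have eqP z : `[< in_cycle u (z * x^-1) >] = `[< in_cycle u (z * y^-1) >].
  apply/asboolP/asboolP=> uz; first exact: cycle_trans uz xy.
  by apply: cycle_trans uz _; rewrite -invgF; apply: in_cycleV.
rewrite (eq_choose eqP); apply: choose_id; last first.
  by apply/asboolP; rewrite mulgV; apply: in_cycle1.
exact/asboolP.
Qed.

Lemma coset_rep_mul x z : coset_rep (coset_rep x * z) = coset_rep (x * z).
Proof. by apply/coset_repP; rewrite mulgKA; apply: coset_rep_cycle. Qed.

End Cycle.

Lemma free_product_inj (I : Type) (A : I -> groupType) (F : groupType)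
    (inj : forall i, {multiplicative A i -> F}) i :
  is_free_product inj -> injective (inj i).
Proof.
move=> hF a b eq_ab.
pose f j : {multiplicative A j -> A i} :=
  match pselect (i = j) with
  | left e => ecast k {multiplicative A k -> A i} e
                (gmorph_of (f := id) (fun x y => erefl (x * y)))
  | right _ => trivial_gmorph (A j) (A i)
  end.
have f_id x : f i x = x.
  by rewrite /f; case: pselect => // e; rewrite (Prop_irrelevance e erefl).
have [h hE _] := hF _ f.
by rewrite -(f_id a) -hE eq_ab hE f_id.
Qed.

Section FreeProduct.

Variables (I : Type) (A : I -> groupType) (F : groupType).
Variable inj : forall i, {multiplicative A i -> F}.
Hypothesis hF : is_free_product inj.
Hypothesis rfA : forall i, residually_finite (A i).
Variables (u : F) (u1 : u <> 1) (u_conj : ~ in_conjugate_of_factor inj u).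

Lemma coset_free t i (a b : A i) :
  coset_rep u (t * inj i a) = coset_rep u (t * inj i b) -> a = b.
Proof.
have conj_power n (c : A i) : t * inj i c * t^-1 = u ^+ n -> c = 1.
  case: n => [|n] eq_c.
    apply: (free_product_inj hF (i := i)); rewrite gmorph1.
    by apply: (mulgI t); apply: (mulIg t^-1); rewrite eq_c mulg1 mulgV.
  case: (hyperbolic_power_conj hF rfA u1 u_conj (n := n.+1) (a := c) (g :=
    t^-1)) => //.
  by rewrite conjgE invgK mulgA.
move/coset_repP; rewrite invgM mulgA -(mulgA t) -gmorphV -gmulfM =>
  -[n [|] eq_n].
  exact/divg1_eq/conj_power/eq_n.
apply/esym/divg1_eq/(conj_power n); rewrite -[RHS]invgK -eq_n !invgM invgK.
by rewrite -gmorphV invgM invgK mulgA.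
Qed.

Section Trajectory.

Variable w : seq {i & A i}.

Let points := [seq coset_rep u (eval_word inj (take k w)) | k <- iota 0 (size
  w).+1].
Let S : finType := seq_sub points.
Implicit Types s t : S.

Let points_rep s : coset_rep u (val s) = val s.
Proof.
have /mapP[k _ ->] := valP s.
by have := coset_rep_mul u (eval_word inj (take k w)) 1; rewrite !mulg1.
Qed.

Definition factor_rel i s t := exists a, coset_rep u (val t * inj i a) = val s.

Lemma factor_rel_refl i s : factor_rel i s s.
Proof. by exists 1; rewrite gmorph1 mulg1 points_rep. Qed.

Definition factor_rep i s := odflt s [pick t | `[< factor_rel i s t >]].

Lemma factor_repP i s : factor_rel i s (factor_rep i s).
Proof.
rewrite /factor_rep; case: pickP => [t /asboolP //|/(_ s)/asboolP[]].
exact: factor_rel_refl.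
Qed.

Definition factor_elt i s : A i := sval (cid (factor_repP i s)).

Lemma factor_eltP i s :
  coset_rep u (val (factor_rep i s) * inj i (factor_elt i s)) = val s.
Proof. exact: (svalP (cid (factor_repP i s))). Qed.

Lemma factor_chart_inj i : injective (fun s => (factor_rep i s,
  factor_elt i s)).
Proof.
by move=> s s' [rho_eq g_eq]; apply: val_inj;
  rewrite -(factor_eltP i s) rho_eq g_eq factor_eltP.
Qed.

Lemma factor_rep_step i s s' a : val s' = coset_rep u (val s * inj i a) ->
  factor_rep i s' = factor_rep i s.
Proof.
move=> s'E.
have eq_rel t : `[< factor_rel i s' t >] = `[< factor_rel i s t >].
  apply/asboolP/asboolP=> -[b bE].
    exists (b * a^-1); rewrite gmulfM mulgA -coset_rep_mul bE s'E coset_rep_mul.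
    by rewrite gmorphV mulgK points_rep.
  by exists (b * a); rewrite gmulfM mulgA -coset_rep_mul bE s'E.
rewrite /factor_rep (eq_pick eq_rel); case: pickP => // /(_ s)/asboolP[].
exact: factor_rel_refl.
Qed.

Lemma factor_elt_step i s s' a : val s' = coset_rep u (val s * inj i a) ->
  factor_elt i s' = factor_elt i s * a.
Proof.
move=> s'E; apply: (@coset_free (val (factor_rep i s))).
rewrite -{1}(factor_rep_step s'E) factor_eltP gmulfM mulgA s'E.
by rewrite -[RHS]coset_rep_mul factor_eltP.
Qed.

(* [F] acts on the right cosets of [<u>]; only the cosets visited by the prefixes
   of [w] are kept, and completed to a finite set. *)
Lemma word_coset_action :
  exists (X : finType) (f : {multiplicative F -> {perm X}}) (x0 : X),
  forall k, k <= size w ->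
    f (eval_word inj (take k w)) x0 =
      x0 <-> in_cycle u (eval_word inj (take k w)).
Proof.
have [X [j [f [j_inj fP]]]] := local_action (fun k => tag (tnth (in_tuple w) k))
  rfA hF factor_chart_inj.
have pt_in k : k <= size w -> coset_rep u (eval_word inj (take k w)) \in points.
  by move=> le_k; apply/mapP; exists k; rewrite // mem_iota.
pose pt k (le_k : k <= size w) : S := SeqSub (pt_in k le_k).
have trajectory k (le_k : k <= size w) :
    f (eval_word inj (take k w)) (j (pt 0 isT)) = j (pt k le_k).
  elim: k le_k => [|k IHk] lt_k.
    rewrite take0 /eval_word big_nil gmorph1 perm1; congr (j _); exact: val_inj.
  pose s := tnth (in_tuple w) (Ordinal lt_k).
  have take_w : take k.+1 w = rcons (take k w) s.
    by rewrite (take_nth s lt_k) -[nth _ _ _](tnth_nth s (in_tuple w) (Ordinal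
      lt_k)).
  rewrite take_w -cats1 eval_word_cat gmulfM permM IHk ?(ltnW lt_k) // => le_k.
  rewrite /eval_word big_seq1.
  have ptE : val (pt k.+1 lt_k) = coset_rep u (val (pt k le_k) * letter inj s).
    by rewrite /= coset_rep_mul take_w -cats1 eval_word_cat {2}/eval_word
      big_seq1.
  apply: (fP (Ordinal lt_k));
    [exact: factor_rep_step ptE|exact: factor_elt_step ptE].
exists X, f, (j (pt 0 isT)) => k le_k; rewrite trajectory.
split=> [/j_inj/(congr1 val)/=|u_k].
  by move/coset_repP; rewrite take0 {2}/eval_word big_nil divg1.
congr (j _); apply: val_inj; apply/coset_repP.
by rewrite take0 {2}/eval_word big_nil divg1.
Qed.

End Trajectory.

Lemma hyperbolic_cycle_separable x : ~ in_cycle u x ->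
  exists (Q : finGroupType) (f : {multiplicative F -> Q}), f x \notin <[f u]>.
Proof.
move=> ux; have [wu uE] := free_product_word hF u.
have [wx xE] := free_product_word hF x.
have [X [f [x0 fP]]] := word_coset_action (wu ++ wx).
exists {perm X}, f.
have fu : f u x0 = x0.
  have := fP (size wu); rewrite size_cat leq_addr take_size_cat // -uE => -> //.
  exact: in_cycle_id.
have fx : f x x0 <> x0.
  have := fP _ (leqnn _); rewrite take_size eval_word_cat -uE -xE.
  rewrite gmulfM permM fu => -> u_ux; apply: ux.
  by rewrite -(mulKg u x); apply: in_cycleM => //; apply/in_cycleV/in_cycle_id.
apply/negP=> /cycleP[n fxE]; apply: fx; rewrite fxE.
by elim: n {fxE} => [|n IHn]; rewrite ?perm1 // expgSr permM IHn.
Qed.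

End FreeProduct.

(** * Gluing semiregular permutations *)

Lemma pair_expg (P Q : finGroupType) (x : P) (y : Q) n :
  ((x, y) : P * Q) ^+ n = (x ^+ n, y ^+ n).
Proof. by elim: n => // n IHn; rewrite !expgS IHn. Qed.

Lemma order_pair (P Q : finGroupType) (x : P) (y : Q) :
  #[x] %| #[y] -> #[(x, y) : P * Q] = #[y].
Proof.
move=> x_dvd_y; apply/eqP; rewrite eqn_dvd !order_dvdn pair_expg.
rewrite expg_order (eqP (_ : x ^+ #[y] == 1)) -?order_dvdn // eqxx /=.
have /eqP := expg_order ((x, y) : P * Q); rewrite pair_expg.
by case/eqP=> _ /eqP; rewrite order_dvdn.
Qed.

Lemma cycle_pair (P Q : finGroupType) (x x' : P) (y y' : Q) :
  ((x', y') : P * Q) \in <[(x, y) : P * Q]> -> x' \in <[x]> /\ y' \in <[y]>.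
Proof.
by case/cycleP=> n; rewrite pair_expg => -[-> ->]; rewrite !mem_cycle.
Qed.

Section FreeProduct.

Variables (I : Type) (A : I -> groupType) (F : groupType).
Variable inj : forall i, {multiplicative A i -> F}.
Hypothesis hF : is_free_product inj.
Hypothesis rfA : forall i, residually_finite (A i).
Variables (u : F) (u1 : u <> 1) (u_conj : ~ in_conjugate_of_factor inj u).

Lemma hyperbolic_cycle_separable_seq (xs : seq F) :
  (forall x, x \in xs -> ~ in_cycle u x) ->
  exists (Q : finGroupType) (f : {multiplicative F -> Q}),
    forall x, x \in xs -> f x \notin <[f u]>.
Proof.
elim: xs => [|x xs IHxs] u_xs.
  by exists {perm 'I_1}, (trivial_gmorph F _).
have [|P [f fP]] := hyperbolic_cycle_separable hF rfA u1 u_conj (x := x).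
  by apply: u_xs; rewrite inE eqxx.
have [|Q [g gP]] := IHxs; first by move=> y xs_y; apply: u_xs;
  rewrite inE xs_y orbT.
exists (P * Q)%type, (pair_gmorph f g) => y xs_y.
apply/negP=> /cycle_pair[fy gy]; move: xs_y; rewrite inE => /predU1P[eq_y|/gP].
  by move: fP; rewrite -eq_y fy.
by rewrite gy.
Qed.

Lemma hyperbolic_quotients (xs : seq F) :
  (forall x, x \in xs -> ~ in_cycle u x) ->
  exists2 K, 0 < K & forall l, 0 < l ->
    exists (Q : finGroupType) (f : {multiplicative F -> Q}),
      #[f u] = (K * l)%N /\ forall x, x \in xs -> f x \notin <[f u]>.
Proof.
move=> u_xs.
have [P [f fP]] := hyperbolic_cycle_separable_seq u_xs.
have [K K_gt0 KP] := hyperbolic_finite_orders hF rfA u1 u_conj.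
exists (K * #[f u])%N => [|l l_gt0]; first by rewrite muln_gt0 K_gt0 order_gt0.
have [|Q [g gu]] := KP (#[f u] * l)%N; first by rewrite muln_gt0 order_gt0.
exists (P * Q)%type, (pair_gmorph f g); split=> [|x /fP].
  by rewrite order_pair gu -?mulnA // dvdn_mull // dvdn_mulr.
by apply: contraNN => /cycle_pair[].
Qed.

End FreeProduct.

Section SemiregularPermutations.

Variables (Z : finType) (m : nat).
Hypothesis m_gt0 : 0 < m.
Implicit Types (U V : {perm Z}) (xs ys : seq Z).

Definition semiregular U :=
  forall z a b, (U ^+ a) z = (U ^+ b) z <-> a = b %[mod m].

Definition transversal_seq U xs :=
  uniq (map (porbit U) xs) /\ forall z, porbit U z \in map (porbit U) xs.

Lemma card_porbit_semiregular U z : semiregular U -> #|porbit U z| = m.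
Proof.
move=> regU; have -> : porbit U z = [set (U ^+ val a) z | a : 'I_m].
  apply/setP=> y; apply/porbitP/imsetP=> [[a ->]|[a _ ->]]; last by exists a.
  exists (Ordinal (ltn_pmod a m_gt0)) => //=.
  by apply/regU; rewrite modn_mod.
rewrite card_imset ?card_ord // => a b /regU.
by rewrite !modn_small ?ltn_ord // => /val_inj.
Qed.

Lemma card_porbits_semiregular U : semiregular U -> #|Z| = (#|porbits U| * m)%N.
Proof.
move=> regU; rewrite -cardsT; apply: card_uniform_partition.
  by move=> _ /imsetP[z _ ->]; apply: card_porbit_semiregular.
suff -> : porbits U = preim_partition (porbit U) [set: Z].
  exact: preim_partitionP.
have block z : porbit U z = [set y in [set: Z] | porbit U z == porbit U y].
  by apply/setP=> y; rewrite !inE eq_sym eq_porbit_mem.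
apply/setP=> O; apply/imsetP/imsetP=> -[z _ ->]; exists z; rewrite ?inE //.
Qed.

Lemma transversal_extend U xs : uniq (map (porbit U) xs) ->
  exists ts, transversal_seq U (xs ++ ts).
Proof.
move=> uniq_xs.
have orbit_rep (O : {set Z}) : O \in porbits U -> exists z, porbit U z = O.
  by case/imsetP=> z _ ->; exists z.
pose os := [seq O <- enum (porbits U) | O \notin map (porbit U) xs].
have [ts tsE] : exists ts, map (porbit U) ts = os.
  have : {subset os <= porbits U} by move=> O;
    rewrite mem_filter mem_enum => /andP[].
  elim: os => [|O os IHos] sub_os; first by exists [::].
  have [z zO] := orbit_rep O (sub_os _ (mem_head _ _)).
  have [|ts tsE] := IHos; first by move=> O' os_O'; apply: sub_os;
    rewrite inE os_O' orbT.
  by exists (z :: ts); rewrite /= zO tsE.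
exists ts; split=> [|z]; rewrite map_cat tsE.
  rewrite cat_uniq uniq_xs filter_uniq ?enum_uniq // andbT /=.
  by apply/hasPn=> O; rewrite mem_filter => /andP[].
rewrite mem_cat mem_filter mem_enum imset_f // andbT.
by case: (_ \in _).
Qed.

Lemma transversal_size U xs : transversal_seq U xs -> size xs = #|porbits U|.
Proof.
move=> [uniq_xs xsP]; rewrite -(size_map (porbit U)) -(card_uniqP uniq_xs).
apply: eq_card => O; apply/idP/imsetP => [/mapP[z _ ->]|[z _ ->//]].
by exists z.
Qed.

Lemma transversal_map U V xs ys : semiregular U -> semiregular V ->
  transversal_seq U xs -> size xs = size ys ->
  exists f : Z -> Z, forall z0 i a, i < size xs ->
    f ((U ^+ a) (nth z0 xs i)) = (V ^+ a) (nth z0 ys i).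
Proof.
move=> regU regV [uniq_xs xsP] size_ys.
pose rk z := index (porbit U z) (map (porbit U) xs).
have lt_rk z : rk z < size xs by rewrite -(size_map (porbit U)) index_mem.
have ex_a z : exists a, z = (U ^+ a) (nth z xs (rk z)).
  apply/porbitP; rewrite -eq_porbit_mem -(nth_map z (porbit U z)) //.
  by rewrite nth_index.
have [a aP] := choice ex_a.
exists (fun z => (V ^+ a z) (nth z ys (rk z))) => z0 i b lt_i.
set z := (U ^+ b) _.
have rk_z : rk z = i.
  rewrite /rk /z porbit_perm -(nth_map z0 (porbit U z0)) // index_uniq //.
  by rewrite size_map.
rewrite rk_z (set_nth_default z0) -?size_ys //.
apply/regV/(regU (nth z0 xs i)); have := aP z.
by rewrite rk_z (set_nth_default z0).
Qed.

Lemma semiregular_conj U V xs ys : semiregular U -> semiregular V ->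
  uniq (map (porbit U) xs) -> uniq (map (porbit V) ys) -> size xs = size ys ->
  exists theta : {perm Z}, U * theta = theta * V /\
    forall z0 i, i < size xs -> theta (nth z0 xs i) = nth z0 ys i.
Proof.
move=> regU regV uniq_xs uniq_ys size_ys.
have [xs' trU] := transversal_extend uniq_xs.
have [ys' trV] := transversal_extend uniq_ys.
have size_eq : size (xs ++ xs') = size (ys ++ ys').
  rewrite (transversal_size trU) (transversal_size trV); apply/eqP.
  by rewrite -(eqn_pmul2r m_gt0) -!card_porbits_semiregular.
have [f fP] := transversal_map regU regV trU size_eq.
have [g gP] := transversal_map regV regU trV (esym size_eq).
have coord W zs : transversal_seq W zs -> forall z,
    exists i a, i < size zs /\ z = (W ^+ a) (nth z zs i).
  move=> [_ zsP] z; have := zsP z; rewrite -index_mem size_map => lt_i.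
  exists (index (porbit W z) (map (porbit W) zs)).
  have /porbitP[a zE] : z \in porbit W (nth z zs (index (porbit W z) (map
    (porbit W) zs))).
    by rewrite -eq_porbit_mem -(nth_map z (porbit W z)) // nth_index.
  by exists a.
have fK : cancel f g.
  move=> z; have [i [a [lt_i ->]]] := coord _ _ trU z.
  by rewrite fP // gP // -size_eq.
exists (perm (can_inj fK)); split.
  apply/permP=> z; rewrite !permM !permE;
    have [i [a [lt_i ->]]] := coord _ _ trU z.
  by rewrite fP // -!permM -!expgSr fP.
move=> z0 i lt_i; rewrite permE.
have := fP z0 i 0 _; rewrite !perm1 !nth_cat -size_ys lt_i; apply.
by rewrite size_cat ltn_addr.
Qed.

End SemiregularPermutations.

Lemma semiregular_conj_fun (Z K : finType) (m : nat) (U V : {perm Z})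
    (xi eta : K -> Z) : 0 < m -> semiregular m U -> semiregular m V ->
  injective (fun k => porbit U (xi k)) ->
    injective (fun k => porbit V (eta k)) ->
  exists theta : {perm Z}, U * theta = theta * V /\
    forall k, theta (xi k) = eta k.
Proof.
move=> m_gt0 regU regV xi_inj eta_inj.
have [|||theta [conjUV thetaP]] := semiregular_conj m_gt0 regU regV
    (xs := map xi (enum K)) (ys := map eta (enum K)).
- by rewrite -map_comp map_inj_uniq ?enum_uniq.
- by rewrite -map_comp map_inj_uniq ?enum_uniq.
- by rewrite !size_map.
exists theta; split=> // k.
have lt_k : enum_rank k < size (enum K) by rewrite -cardE.
have := thetaP (xi k) (enum_rank k); rewrite size_map => /(_ lt_k).
by rewrite !(nth_map k _ _ lt_k) nth_enum_rank.
Qed.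

Section RegularCopies.

(* [Z] is identified with copies, indexed by [T], of the right regular
   representation of [P]. *)
Variables (P : finGroupType) (T : Type) (Z : finType).
Variables (e : Z -> P * T) (d : P * T -> Z).
Hypotheses (eK : cancel e d) (dK : cancel d e).

Lemma regular_copies_subproof (a : P) :
  cancel (fun z => d ((e z).1 * a, (e z).2)) (fun z => d ((e z).1 * a^-1,
    (e z).2)).
Proof. by move=> z; rewrite dK /= mulgK -surjective_pairing eK. Qed.

Lemma regular_copiesM :
  {morph (fun a => perm (can_inj (regular_copies_subproof a))) : a b / a * b}.
Proof. by move=> a b; apply/permP=> z; rewrite permM !permE dK /= mulgA. Qed.

Definition regular_copies : {multiplicative P -> {perm Z}} :=
  gmorph_of regular_copiesM.

Lemma regular_copiesE a x t : regular_copies a (d (x, t)) = d (x * a, t).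
Proof. by rewrite permE dK. Qed.

Lemma regular_copies_semiregular a : semiregular #[a] (regular_copies a).
Proof.
move=> z k l; rewrite -(eK z); case: (e z) => x t.
rewrite -!gmorphX !regular_copiesE; split.
  by move=> /(can_inj dK)[/mulgI/eqP]; rewrite eq_expg_mod_order => /eqP.
by move=> /eqP; rewrite -eq_expg_mod_order => /eqP->.
Qed.

Lemma porbit_regular_copies a x t x' t' :
  porbit (regular_copies a) (d (x, t)) = porbit (regular_copies a) (d (x',
    t')) ->
  t = t' /\ x'^-1 * x \in <[a]>.
Proof.
move/eqP; rewrite eq_porbit_mem => /porbitP[k].
rewrite -gmorphX regular_copiesE => /(can_inj dK)[-> ->].
by rewrite mulKg mem_cycle.
Qed.

End RegularCopies.

(* Copies [k] of the regular representations of [P] and of [Q] are glued into a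
   chain along cycles of [x] and [y], following the letters of the word, so that
   the word moves the base point of copy 0 to copy [size s]. *)
Lemma finite_amalgam_action (P Q : finGroupType) (x : P) (y : Q)
    (s : seq (P * Q)) (c : P) :
  #[x] = #[y] ->
  (forall k, k < size s -> (nth (1, 1) s k).2 \notin <[y]>) ->
  (forall k, 0 < k < size s -> (nth (1, 1) s k).1 \notin <[x]>) ->
  (size s = 0 -> c != 1) ->
  exists (Z : finType) (rP : {multiplicative P -> {perm Z}})
      (rQ : {multiplicative Q -> {perm Z}}),
    rP x = rQ y /\ (\prod_(p <- s) (rP p.1 * rQ p.2)) * rP c <> 1.
Proof.
move=> order_xy s2 s1 c1; pose n := size s.
pose Z : finType := (P * (Q * 'I_n.+1))%type.
pose swap (z : Z) := (z.2.1, (z.1, z.2.2)).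
pose unswap (z : Q * (P * 'I_n.+1)) : Z := (z.2.1, (z.1, z.2.2)).
have swapK : cancel swap unswap by case=> a [b t].
have unswapK : cancel unswap swap by case=> a [b t].
have idK : cancel (id : Z -> Z) id by [].
pose rP := regular_copies idK idK; pose rQ := regular_copies swapK unswapK.
have rPE a a' t : rP a (a', t) = (a' * a, t) by exact: regular_copiesE.
have rQE b a' b' t : rQ b (a', (b', t)) = (a', (b' * b, t)).
  exact: (regular_copiesE swapK unswapK b b' (a', t)).
have orbP a b t a' b' t' :
    porbit (rP x) (a, (b, t)) = porbit (rP x) (a', (b', t')) ->
    t = t' /\ a'^-1 * a \in <[x]>.
  move=> eq_orb; have [|[_ ->] //] := @porbit_regular_copies _ _ _ _ _ idK idK
    x a (b, t) a' (b', t').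
  exact: eq_orb.
have orbQ a b t a' b' t' :
    porbit (rQ y) (a, (b, t)) = porbit (rQ y) (a', (b', t')) ->
    t = t' /\ b'^-1 * b \in <[y]>.
  move=> eq_orb; have [|[_ ->] //] := @porbit_regular_copies _ _ _ _ _
    swapK unswapK y b (a, t) b' (a', t').
  exact: eq_orb.
pose letter_at (k : 'I_n) := nth (1, 1) s k.
pose lower (k : 'I_n) : 'I_n.+1 := inord k.
pose upper (k : 'I_n) : 'I_n.+1 := inord k.+1.
have lowerE k : lower k = k :> nat by rewrite inordK // ltnW // ltnS.
have upperE k : upper k = k.+1 :> nat by rewrite inordK // ltnS.
pose xi (k : 'I_n + 'I_n) : Z := match k with
  | inl k => ((letter_at k).1, (1, lower k)) | inr k => (1, (1, upper k)) end.
pose eta (k : 'I_n + 'I_n) : Z := match k with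
  | inl k => (1, (1, lower k)) | inr k => (1, ((letter_at k).2, lower k)) end.
have lower_inj : injective lower.
  by move=> k l /(congr1 val); rewrite /= !lowerE => /val_inj.
have upper_inj : injective upper.
  by move=> k l /(congr1 val); rewrite /= !upperE => -[] /val_inj.
have xi_mixed k l : porbit (rP x) (xi (inl k)) <> porbit (rP x) (xi (inr l)).
  case/orbP => /(congr1 val); rewrite /= lowerE upperE invg1 mul1g => kE.
  by apply/negP/s1; rewrite ltn_ord kE.
have eta_mixed k l : porbit (rQ y) (eta (inl k)) <> porbit (rQ y) (eta (inr l)).
  by case/orbQ=> _; rewrite mulg1 groupV; apply/negP/s2.
have xi_inj : injective (fun k => porbit (rP x) (xi k)).
  move=> [k|k] [l|l]; [|by move/xi_mixed|by move/esym/xi_mixed|].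
    by case/orbP=> /lower_inj->.
  by case/orbP=> /upper_inj->.
have eta_inj : injective (fun k => porbit (rQ y) (eta k)).
  move=> [k|k] [l|l]; [|by move/eta_mixed|by move/esym/eta_mixed|].
    by case/orbQ=> /lower_inj->.
  by case/orbQ=> /lower_inj->.
have regx := regular_copies_semiregular idK idK x.
have := regular_copies_semiregular swapK unswapK y; rewrite -order_xy => regy.
have [theta [conj_theta thetaP]] :=
  semiregular_conj_fun (order_gt0 x) regx regy xi_inj eta_inj.
pose rQ' := conj_gmorph rQ theta^-1.
exists Z, rP, rQ'; split.
  by rewrite /rQ' /= conjgE invgK mulgA -conj_theta mulgK.
have step (k : 'I_n) :
    (rP (letter_at k).1 * rQ' (letter_at k).2) (1, (1, lower k)) = (1, (1,
      upper k)).
  have rP_k : rP (letter_at k).1 (1, (1,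
    lower k)) = xi (inl k) by rewrite rPE mul1g.
  have rQ_k : rQ (letter_at k).2 (eta (inl k)) =
    eta (inr k) by rewrite rQE mul1g.
  rewrite permM rP_k -[rQ' _]/(rQ _ ^ theta^-1) conjgE invgK !permM thetaP rQ_k.
  by rewrite -thetaP permK.
have path k : k <= n ->
    (\prod_(p <- take k s) (rP p.1 * rQ' p.2)) (1, (1, ord0)) = (1, (1,
      inord k)).
  elim: k => [|k IHk] lt_k.
    by rewrite take0 big_nil perm1; congr (_, (_, _)); apply: val_inj;
      rewrite /= inordK.
  rewrite (take_nth (1, 1) lt_k) -cats1 big_cat big_seq1 permM /= IHk ?(ltnW
    lt_k) //.
  exact: (step (Ordinal lt_k)).
move/permP/(_ (1, (1, ord0))); rewrite permM perm1.
have := path n (leqnn n); rewrite take_size => ->; rewrite rPE mul1g.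
case=> c_eq1 /(congr1 val); rewrite /= inordK // => n0.
by have := c1 n0; rewrite c_eq1 eqxx.
Qed.

(** * Amalgamated words *)

Section CycleIso.

Variables (F G : groupType) (u : F) (v : G) (phi : cycle_of u -> cycle_of v).
Hypotheses (hphi : is_subgroup_iso phi) (phi_u :
  phi (cycle_gen u) = cycle_gen v).

Lemma cycle_iso_expg n (c : cycle_of u) :
  sval c = u ^+ n -> sval (phi c) = v ^+ n.
Proof.
have [_ phiM] := hphi; elim: n c => [|n IHn] c cE.
  have /phiM eq_c : sval c = sval c * sval c by rewrite cE mulg1.
  by apply: (mulgI (sval (phi c))); rewrite -eq_c mulg1.
have un : in_cycle u (u ^+ n) by exists n; left.
rewrite (phiM (cycle_gen u) (exist _ _ un)) ?cE ?expgS //.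
by rewrite phi_u (IHn (exist _ _ un)).
Qed.

Lemma cycle_iso_expVg n (c : cycle_of u) :
  sval c = u ^- n -> sval (phi c) = v ^- n.
Proof.
have [_ phiM] := hphi; move=> cE.
have un : in_cycle u (u ^+ n) by exists n; left.
have u0 : in_cycle u 1 by exists 0; left.
have /phiM : sval (exist _ _ u0) = sval c * sval (exist _ _ un).
  by rewrite /= cE mulVg.
rewrite (@cycle_iso_expg 0 (exist _ _ u0)) // (@cycle_iso_expg n (exist _ _
  un)) //.
by move/esym/eqP; rewrite mulg_eq1 => /eqP.
Qed.

Lemma cycle_iso_eq1 : u = 1 <-> v = 1.
Proof.
split=> [u1|v1].
  by have := @cycle_iso_expg 0 (cycle_gen u) u1; rewrite phi_u.
have u0 : in_cycle u 1 by exists 0; left.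
have phi0 : phi (exist _ _ u0) = phi (cycle_gen u).
  rewrite phi_u; case: (phi _) (@cycle_iso_expg 0 (exist _ _ u0) erefl) =>
    y vy /= yE.
  by apply: eq_exist; rewrite yE v1.
by have [/bij_inj phi_inj _] := hphi; move/phi_inj/(congr1 sval): phi0.
Qed.

End CycleIso.

Section Amalgam.

Variables (F G H : groupType) (u : F) (v : G).
Variables (injF : {multiplicative F -> H}) (injG : {multiplicative G -> H}).

Definition eval_amalgam (s : seq (F * G)) (c : F) : H :=
  (\prod_(p <- s) (injF p.1 * injG p.2)) * injF c.

Lemma amalgam_word (phi : cycle_of u -> cycle_of v) (h : H) :
  is_amalgamated_product phi injF injG -> exists s c, h = eval_amalgam s c.
Proof.
move=> hH; pose S h := exists s c, h = eval_amalgam s c.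
have SF x : S (injF x) by exists [::], x; rewrite /eval_amalgam big_nil mul1g.
have SG y : S (injG y).
  by exists [:: (1, y)], 1; rewrite /eval_amalgam big_seq1 /= !gmorph1 mul1g
    mulg1.
have SM x y : S x -> S y -> S (x * y).
  move=> [s [c ->]] [s' [c' ->]]; exists (s ++ (c, 1) :: s'), c'.
  by rewrite /eval_amalgam big_cat big_cons /= gmorph1 mulg1 !mulgA.
have SV x : S x -> S x^-1.
  move=> [s [c ->]]; rewrite /eval_amalgam.
  elim: s => [|[a b] s IHs]; first by rewrite big_nil mul1g -gmorphV.
  rewrite big_cons /= -mulgA invgM; apply: (SM) => //.
  by rewrite invgM -!gmorphV; apply: (SM).
apply: (amalgamated_product_gen (S := S) hH) => //.
by rewrite -(gmorph1 injF).
Qed.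

Lemma reduced_amalgam_word (h : H) : injF u = injG v ->
  (exists s c, h = eval_amalgam s c) ->
  exists s c, [/\ h = eval_amalgam s c,
    forall k, k < size s -> ~ in_cycle v (nth (1, 1) s k).2 &
    forall k, 0 < k < size s -> ~ in_cycle u (nth (1, 1) s k).1].
Proof.
move=> injuv ex_word.
have FtoG a : in_cycle u a -> exists d, injF a = injG d.
  case=> n [->|->]; [exists (v ^+ n)|exists (v ^- n)].
    by rewrite !gmorphX injuv.
  by rewrite !gmorphV !gmorphX injuv.
have GtoF b : in_cycle v b -> exists d, injG b = injF d.
  case=> n [->|->]; [exists (u ^+ n)|exists (u ^- n)].
    by rewrite !gmorphX injuv.
  by rewrite !gmorphV !gmorphX injuv.
pose P n := `[< exists s c, size s = n /\ h = eval_amalgam s c >].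
have exP : exists n, P n.
  by have [s [c hE]] := ex_word; exists (size s); apply/asboolP; exists s, c.
have [m /asboolP[s [c [sm hE]]] min_m] := ex_minnP exP.
have short s' c' : size s' < m -> h <> eval_amalgam s' c'.
  move=> lt_m hE'; move: lt_m; rewrite ltnNge min_m //.
  by apply/asboolP; exists s', c'.
exists s, c; split=> // k.
  move=> lt_k /GtoF[d dE].
  have sE : s = take k s ++ nth (1, 1) s k :: drop k.+1 s.
    by rewrite -drop_nth // cat_take_drop.
  move: (nth _ _ _) dE sE => [a b] /= dE sE.
  move: hE sm short; rewrite sE; move: (take k s) (drop k.+1 s) => t1 t2.
  case: t2 => [|[a' b'] t2] -> <- short.
    apply: (short t1 (a * d * c)); first by rewrite size_cat addn1.
    by rewrite /eval_amalgam big_cat big_seq1 /= !gmulfM dE !mulgA.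
  apply: (short (t1 ++ (a * d * a', b') :: t2) c).
    by rewrite !size_cat /= !addnS.
  by rewrite /eval_amalgam !big_cat !big_cons /= !gmulfM dE !mulgA.
case: k => // k /= lt_k /FtoG[d dE].
have sE : s = take k s ++ nth (1, 1) s k :: nth (1, 1) s k.+1 :: drop k.+2 s.
  by rewrite -!drop_nth ?cat_take_drop // ltnW.
move: (nth _ _ k) (nth _ _ k.+1) dE sE => [a' b'] [a b] /= dE sE.
move: hE sm short; rewrite sE; move: (take k s) (drop k.+2 s) => t1 t2.
move=> -> <- short.
apply: (short (t1 ++ (a', b' * d * b) :: t2) c);
  first by rewrite !size_cat /= !addnS.
by rewrite /eval_amalgam !big_cat !big_cons /= !gmulfM dE !mulgA.
Qed.

End Amalgam.

Theorem theorem3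
  (I J : Type) (A : I -> groupType) (B : J -> groupType)
  (hA : forall i : I, residually_finite (A i))
  (hB : forall j : J, residually_finite (B j))
  (F G : groupType)
  (injA : forall i : I, {multiplicative A i -> F})
  (injB : forall j : J, {multiplicative B j -> G})
  (hF : is_free_product injA)
  (hG : is_free_product injB)
  (u : F) (hu : ~ in_conjugate_of_factor injA u)
  (v : G) (hv : ~ in_conjugate_of_factor injB v)
  (phi : cycle_of u -> cycle_of v)
  (hphi : is_subgroup_iso phi)
  (hphiu : phi (cycle_gen u) = cycle_gen v)
  (H : groupType)
  (injF : {multiplicative F -> H}) (injG : {multiplicative G -> H})
  (hH : is_amalgamated_product phi injF injG) :
  residually_finite H.
Proof.
have injuv : injF u = injG v by have := hH.1 (cycle_gen u); rewrite hphiu.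
have triv_factor (K : Type) (C : K -> groupType) (E : groupType)
    (inj : forall k, {multiplicative C k -> E}) (w : E) :
    is_free_product inj -> ~ in_conjugate_of_factor inj w -> w = 1 ->
    forall x, x = 1 :> E.
  move=> hE w_conj w1; apply: (free_product_gen hE) => //.
  - by move=> _ _ -> ->; rewrite mulg1.
  - by move=> _ ->; rewrite invg1.
  - by move=> k; case: w_conj; exists k, 1, 1; rewrite gmorph1 conj1g.
move=> h h1.
have [u1|u1] := pselect (u = 1).
  have v1 : v = 1 by apply/(cycle_iso_eq1 hphi hphiu).
  case: h1; move: h; apply: (amalgamated_product_gen hH) => //.
  - by move=> _ _ -> ->; rewrite mulg1.
  - by move=> _ ->; rewrite invg1.
  - by move=> x; rewrite (triv_factor _ _ _ _ _ hF hu u1 x) gmorph1.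
  - by move=> y; rewrite (triv_factor _ _ _ _ _ hG hv v1 y) gmorph1.
have v1 : v <> 1 by move/(cycle_iso_eq1 hphi hphiu).
have [s [c [hE s2 s1]]] := reduced_amalgam_word injuv (amalgam_word h hH).
pose xs := [seq x <- c :: [seq p.1 | p <- s] | ~~ `[< in_cycle u x >]].
pose ys := [seq y <- [seq p.2 | p <- s] | ~~ `[< in_cycle v y >]].
have [|K K_gt0 KP] := hyperbolic_quotients hF hA u1 hu (xs := xs).
  by move=> x; rewrite mem_filter => /andP[/asboolPn].
have [|L L_gt0 LP] := hyperbolic_quotients hG hB v1 hv (xs := ys).
  by move=> y; rewrite mem_filter => /andP[/asboolPn].
have [T cT] : exists T, in_cycle u c -> exists2 n,
  n <= T & c = u ^+ n \/ c = u ^- n.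
  have [[n cn]|] := pselect (in_cycle u c); last by exists 0.
  by exists n => _; exists n.
have [|P [p [order_pu pP]]] := KP (L * T.+1)%N; first by rewrite muln_gt0 L_gt0.
have [|Q [q [order_qv qP]]] := LP (K * T.+1)%N; first by rewrite muln_gt0 K_gt0.
have lt_order : T < #[p u].
  by rewrite order_pu mulnA leq_pmull // muln_gt0 K_gt0.
pose s' := [seq (p x.1, q x.2) | x <- s].
have nth_s' k : nth (1, 1) s' k = (p (nth (1, 1) s k).1, q (nth (1, 1) s k).2).
  have [lt_k|le_k] := ltnP k (size s); first by rewrite (nth_map (1, 1)).
  by rewrite !nth_default ?size_map //= !gmorph1.
have [||||Z [rP [rQ [rPQ sep]]]] := finite_amalgam_action (x := p u) (y := q v)
    (s := s') (c := p c).
- by rewrite order_pu order_qv mulnCA.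
- move=> k; rewrite size_map nth_s' => lt_k; apply: qP.
  rewrite mem_filter; apply/andP; split; first exact/asboolPn/s2.
  by rewrite -(nth_map _ 1) // mem_nth // size_map.
- move=> k; rewrite size_map nth_s' => /andP[k_gt0 lt_k]; apply: pP.
  rewrite mem_filter; apply/andP; split; first by apply/asboolPn/s1;
    rewrite k_gt0.
  by rewrite inE -(nth_map _ 1) // mem_nth ?orbT // size_map.
- rewrite size_map => /size0nil s0;
    have [/cT[n le_n cE]|uc] := pselect (in_cycle u c).
    have [n0|n_gt0] := posnP n.
      case: h1; rewrite hE s0 /eval_amalgam big_nil mul1g.
      by case: cE => ->; rewrite n0 ?invg1 gmorph1.
    have : p u ^+ n != 1.
      rewrite -order_dvdn gtnNdvd //; exact: leq_ltn_trans lt_order.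
    by case: cE => ->; rewrite ?gmorphV gmorphX ?invg_eq1.
  have : p c \notin <[p u]>.
    by apply: pP; rewrite mem_filter mem_head andbT; apply/asboolPn.
  by apply: contraNneq => ->; apply: group1.
pose f := comp_gmorph rP p; pose g := comp_gmorph rQ q.
have [|r [rF rG] _] := hH.2 _ f g.
  move=> d; have [n [dE|dE]] := svalP d.
    rewrite (cycle_iso_expg hphi hphiu dE) dE !gmorphX.
    by rewrite -[f u]/(rP (p u)) rPQ.
  rewrite (cycle_iso_expVg hphi hphiu dE) dE !gmorphV !gmorphX.
  by rewrite -[f u]/(rP (p u)) rPQ.
exists {perm Z}, r => rh; apply: sep; apply: etrans rh;
  rewrite hE /eval_amalgam gmulfM rF.
congr (_ * _); rewrite big_map.
elim: (s) => [|x t IHt]; first by rewrite !big_nil gmorph1.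
by rewrite !big_cons gmulfM IHt gmulfM rF rG.
Qed.
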